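(* In the abstract discrete setting of the context (discrete spaces and forms, and stability assumptions with constants $\underline\alpha,\overline\alpha,\beta,\gamma$), let $(\boldsymbol{u}_{h\tau},p_{h\tau})=((\boldsymbol{u}_h^n)_{0\le n\le N},(p_h^n)_{0\le n\le N})\in\boldsymbol{\mathsf U}_h^{N+1}\times\mathsf P_h^{N+1}$ solve the abstract discrete problem (D1)--(D4). Set $s_h^N:=\sum_{i=1}^N\tau p_h^i$ and $\mathsf G^n:=\sum_{i=1}^n\tau\mathsf g^i$ for $1\le n\le N$. Then $$\begin{aligned} &\underline{\alpha}\sum_{n=1}^N\tau\|\boldsymbol{u}_h^n\|_{\boldsymbol{\mathsf U},h}^2+\sum_{n=1}^N\tau\left(C_0\|\mathsf r_hp_h^n\|_{L^2(\Omega)}^2+\frac{\beta^2\underline\alpha}{2\overline\alpha^2}\|\mathsf r_hp_h^n-\pi_\Omega^0\mathsf r_hp_h^n\|_{L^2(\Omega)}^2\right)+\gamma\|s_h^N\|_{\mathsf P,h}^2\\ &\quad\le\mathcal C_1\sum_{n=1}^N\tau\|\mathsf f_h^n\|_{\boldsymbol{\mathsf U},h,*}^2+\mathcal C_2\left(\sum_{n=1}^N\tau\|\mathsf G^n\|_{L^2(\Omega)}^2+t_{\rm F}\|\varphi^0\|_{L^2(\Omega)}^2\right)\\ &\qquad+\mathcal C_3\left(\sum_{n=1}^N\tau\|\pi_\Omega^0\mathsf G^n\|_{L^2(\Omega)}^2+t_{\rm F}\|\pi_\Omega^0\varphi^0\|_{L^2(\Omega)}^2\right), \end{aligned}$$ where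 $$\mathcal C_1:=\frac{4\overline\alpha^2+2\underline\alpha^2}{\underline\alpha\,\overline\alpha^2},\qquad\mathcal C_2:=\frac{16\overline\alpha^2}{\underline\alpha\beta^2},\qquad\mathcal C_3:=\frac{4}{C_0},$$ with the convention that, if $C_0=0$, the whole term multiplied by $\mathcal C_3$ is equal to $0$.
   Context: $\Omega\subset\mathbb{R}^d$, $d\in\{2,3\}$, is a bounded connected polyhedral domain, $t_{\rm F}>0$, $C_0\ge0$. $\pi_\Omega^0\varphi:=|\Omega|^{-1}\int_\Omega\varphi$ is the mean-value operator (its value being identified with a constant function). **Discrete spaces and forms.** $N\ge1$ is an integer, $\tau:=t_{\rm F}/N$; for a family $\varphi_\tau=(\varphi^n)_{0\le n\le N}$ in a vector space, $\delta_t^n\varphi_\tau:=(\varphi^n-\varphi^{n-1})/\tau$ for $1\le n\le N$. $\boldsymbol{\mathsf U}_h$ and $\mathsf P_h$ are finite-dimensional real vector spaces; $\mathsf r_h:\mathsf P_h\to L^2(\Omega)$ is linear with range $\mathsf L_h$. $\mathsf a_h:\boldsymbol{\mathsf U}_h\times\boldsymbol{\mathsf U}_h\to\mathbb{R}$, $\mathsf b_h:\boldsymbol{\mathsf U}_h\times\mathsf P_h\to\mathbb{R}$, $\mathsf c_h:\mathsf P_h\times\mathsf P_h\to\mathbb{R}$ are bilinear forms; $\mathsf c_h$ is symmetric; there is a bilinear form $\widetilde{\mathsf b}_h:\boldsymbol{\mathsf U}_h\times\mathsf L_h\to\mathbb{R}$ with $\mathsf b_h(\boldsymbol{v}_h,q_h)=\widetilde{\mathsf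 b}_h(\boldsymbol{v}_h,\mathsf r_hq_h)$ for all $(\boldsymbol{v}_h,q_h)$. The data are linear forms $\mathsf f_h^n:\boldsymbol{\mathsf U}_h\to\mathbb{R}$ and functions $\mathsf g^n\in L^2(\Omega)$, $1\le n\le N$, and $\varphi^0\in L^2(\Omega)$; if $C_0=0$, $\int_\Omega\varphi^0=0$ and $\int_\Omega\mathsf g^n=0$ for all $1\le n\le N$. **Stability.** $\boldsymbol{\mathsf U}_h$ carries a norm $\|\cdot\|_{\boldsymbol{\mathsf U},h}$ and $\mathsf P_h$ a seminorm $\|\cdot\|_{\mathsf P,h}$ that is a norm on $\{q_h\in\mathsf P_h:\int_\Omega\mathsf r_hq_h=0\}$. For a linear form $\ell_h$ on $\boldsymbol{\mathsf U}_h$, $\|\ell_h\|_{\boldsymbol{\mathsf U},h,*}:=\sup_{\boldsymbol{v}_h\ne\boldsymbol 0}\ell_h(\boldsymbol{v}_h)/\|\boldsymbol{v}_h\|_{\boldsymbol{\mathsf U},h}$. There are reals $0<\underline\alpha\le\overline\alpha$, $\gamma>0$, $\beta>0$ such that, for all $\boldsymbol{v}_h,\boldsymbol{w}_h\in\boldsymbol{\mathsf U}_h$ and $q_h\in\mathsf P_h$: $\underline\alpha\|\boldsymbol{v}_h\|_{\boldsymbol{\mathsf U},h}^2\le\mathsf a_h(\boldsymbol{v}_h,\boldsymbol{v}_h)$; $\mathsf a_h(\boldsymbol{w}_h,\boldsymbol{v}_h)\le\overline\alpha\|\boldsymbol{w}_h\|_{\boldsymbol{\mathsf U},h}\|\boldsymbol{v}_h\|_{\boldsymbol{\mathsf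 U},h}$; $\gamma\|q_h\|_{\mathsf P,h}^2\le\mathsf c_h(q_h,q_h)$; $\beta\|\mathsf r_hq_h-\pi_\Omega^0\mathsf r_hq_h\|_{L^2(\Omega)}\le\|\mathsf b_h(\cdot,q_h)\|_{\boldsymbol{\mathsf U},h,*}$. **Abstract discrete problem.** For $n=1,\dots,N$: (D1) $\mathsf a_h(\boldsymbol{u}_h^n,\boldsymbol{v}_h)+\mathsf b_h(\boldsymbol{v}_h,p_h^n)=\mathsf f_h^n(\boldsymbol{v}_h)$ for all $\boldsymbol{v}_h\in\boldsymbol{\mathsf U}_h$; (D2) $C_0(\mathsf r_h\delta_t^np_{h\tau},\mathsf r_hq_h)_{L^2(\Omega)}-\mathsf b_h(\delta_t^n\boldsymbol{u}_{h\tau},q_h)+\mathsf c_h(p_h^n,q_h)=(\mathsf g^n,\mathsf r_hq_h)_{L^2(\Omega)}$ for all $q_h\in\mathsf P_h$; (D3) $C_0(\mathsf r_hp_h^0,\mathsf r_hq_h)_{L^2(\Omega)}-\mathsf b_h(\boldsymbol{u}_h^0,q_h)=(\varphi^0,\mathsf r_hq_h)_{L^2(\Omega)}$ for all $q_h\in\mathsf P_h$; (D4) if $C_0=0$, $\int_\Omega\mathsf r_hp_h^n=0$ for all $1\le n\le N$. *)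

(* Defs.v *)
From HB Require Import structures.
From mathcomp Require Import all_boot all_order all_algebra sesquilinear.
From mathcomp Require Import all_classical all_reals all_analysis.
From mathcomp Require Import measurable_realfun.

Set Implicit Arguments.
Unset Strict Implicit.
Unset Printing Implicit Defensive.

Import Order.TTheory GRing.Theory Num.Theory.
Import numFieldNormedType.Exports.

Local Open Scope classical_set_scope.
Local Open Scope ring_scope.

Section borel_rV.
Variable R : realType.
Notation rT := (measurableTypeR R).

(* 'rV[R]_n is R^n with its sup norm; only its topology matters here. *)
Definition borel_rV (n : nat) : Type := g_sigma_algebraType (@open 'rV[R]_n).
HB.instance Definition _ n := Measurable.on (borel_rV n).

Lemma open_measurable_rV n (A : set 'rV[R]_n) :
  open A -> measurable (A : set (borel_rV n)).
Proof. exact: sub_gen_smallest. Qed.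

Lemma rV_ball_ratE n (A : set 'rV[R]_n) : open A ->
  A = \bigcup_(q in [set q : 'rV[rat]_n * rat |
         ball (map_mx ratr q.1 : 'rV[R]_n) (ratr q.2) `<=` A])
        ball (map_mx ratr q.1 : 'rV[R]_n) (ratr q.2).
Proof.
move=> oA; apply/seteqP; split=> [x Ax|x [q /= qA qx]]; last exact: qA.
have /nbhs_ballP[e /= e0 eA] := open_nbhs_nbhs (conj oA Ax).
have e4 : e / 4 < e / 2 by rewrite ltr_pM2l// ltf_pV2 ?posrE// ltr_nat.
have [r /[!in_itv]/= /andP[er re]] := rat_in_itvoo e4.
have cE i : {c : rat | `|ratr c - x 0 i| < e / 4}.
  apply: cid.
  have h : x 0 i - e / 4 < x 0 i + e / 4.
    by rewrite ltrD2l gtrN// divr_gt0.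
  have [c /[!in_itv]/= cx] := rat_in_itvoo h.
  by exists c; rewrite ltr_distl.
have e40 : 0 < e / 4 by rewrite divr_gt0.
pose c : 'rV[rat]_n := \row_i sval (cE i).
have cx i j : `|ratr (c i j) - x i j| < ratr r :> R.
  by rewrite mxE ord1; case: (cE j) => /= q qx; exact: lt_trans er.
exists (c, r) => /=; last first.
  split=> [|i j]; first exact: lt_trans er.
  by rewrite !mxE -ball_normE /=; have := cx i j; rewrite mxE.
move=> y [_ ycr]; apply: eA; split=> // i j.
have := ycr i j; rewrite !mxE -!ball_normE/= => yc.
rewrite (le_lt_trans (ler_distD (ratr (c i j)) _ _))// [e]splitr ltrD//.
  by rewrite distrC (lt_trans (cx i j)).
by rewrite mxE (lt_trans yc re).
Qed.

Lemma measurable_coord n (i : 'I_n) :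
  measurable_fun [set: borel_rV n] (fun x : 'rV[R]_n => x 0 i : rT).
Proof.
apply: (measurability _ (RGenOpens.measurableE R)) => _ /= [_ [a [b ->]] <-].
rewrite setTI; apply: open_measurable_rV.
by apply: open_comp; [move=> x _; exact: coord_continuous|exact: interval_open].
Qed.

Lemma measurable_fun_rVP d (T : measurableType d) n (f : T -> 'rV[R]_n) :
  (forall i, measurable_fun [set: T] (fun x => f x 0 i : rT)) ->
  measurable_fun [set: T] (f : T -> borel_rV n).
Proof.
move=> mf; apply: (@measurability _ _ T (borel_rV n) setT f (@open 'rV[R]_n) erefl) => _ /= [A oA <-]; rewrite setTI.
rewrite (rV_ball_ratE oA) preimage_bigcup bigcup_mkcond.
apply: countable_bigcupT_measurable => // -[c r] /=; case: ifPn => // _.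
have [r0|r0] := ltP (0 : R) (ratr r); last first.
  rewrite (_ : _ @^-1` _ = set0)//; apply/seteqP; split=> // x /= [].
  by rewrite ltNge r0.
rewrite (_ : _ @^-1` _ = \bigcap_(i in [set: 'I_n])
    ((fun x => f x 0 i) @^-1` ball (ratr (c 0 i) : R) (ratr r))); last first.
  apply/seteqP; split=> x /=.
    by move=> [_ h] i _; have := h 0 i; rewrite mxE.
  by move=> h; split=> // i j; rewrite mxE ord1; exact: h.
apply: fin_bigcap_measurable => // i _.
rewrite -[X in measurable X]setTI; apply: mf => //.
by apply: open_measurable; exact: ball_open.
Qed.

End borel_rV.

Section lebesgue_rV.
Variable R : realType.
Notation rT := (measurableTypeR R).

Definition consrV n (z : rT * borel_rV R n) : borel_rV R n.+1 :=
  \row_(i < n.+1) oapp ((z.2 : 'rV[R]_n) 0) z.1 (unlift ord0 i).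

Definition unconsrV n (x : borel_rV R n.+1) : rT * borel_rV R n :=
  ((x : 'rV[R]_n.+1) 0 0, \row_(j < n) (x : 'rV[R]_n.+1) 0 (lift ord0 j)).

Lemma consrVK n : cancel (@consrV n) (@unconsrV n).
Proof.
case=> a x; rewrite /unconsrV !mxE unlift_none/=; congr pair.
by apply/rowP => j; rewrite !mxE liftK.
Qed.

Lemma measurable_consrV n : measurable_fun [set: rT * borel_rV R n] (@consrV n).
Proof.
apply: measurable_fun_rVP => i.
under [X in measurable_fun _ X]eq_fun do rewrite mxE.
case: (unlift ord0 i) => [j|]/=; last exact: measurable_fst.
exact: (measurableT_comp (measurable_coord j) measurable_snd).
Qed.

Lemma measurable_unconsrV n : measurable_fun [set: borel_rV R n.+1] (@unconsrV n).
Proof.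
apply/measurable_fun_pairP; split; first exact: measurable_coord.
apply: measurable_fun_rVP => i.
under [X in measurable_fun _ X]eq_fun do rewrite mxE.
exact: measurable_coord.
Qed.

(* The library's instance of this fact is shadowed by the one for products of *)
(* subprobability measures, and canonical inference does not find it.         *)
Lemma sigma_finite_prod d1 d2 (T1 : measurableType d1) (T2 : measurableType d2)
    (m1 : {sigma_finite_measure set T1 -> \bar R})
    (m2 : {sigma_finite_measure set T2 -> \bar R}) :
  sigma_finite setT (m1 \x m2)%E.
Proof.
have /sigma_finiteP[F [TF ndF Foo]] := sigma_finiteT m1.
have /sigma_finiteP[G [TG ndG Goo]] := sigma_finiteT m2.
exists (fun n => F n `*` G n).
  rewrite -setXTT TF TG predeqE => -[x y]; split.
    move=> [/= [n _ Fnx] [k _ Gky]]; exists (maxn n k) => //; split.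
    - by move: x Fnx; exact/subsetPset/ndF/leq_maxl.
    - by move: y Gky; exact/subsetPset/ndG/leq_maxr.
  by move=> [n _ []/= ? ?]; split; exists n.
move=> k; have [? ?] := Foo k; have [? ?] := Goo k.
split; first exact: measurableX.
by rewrite product_measure1E// lte_mul_pinfty// ge0_fin_numE.
Qed.

Section succ.
Variables (n : nat) (mu : {sigma_finite_measure set (borel_rV R n) -> \bar R}).

Definition lebesgue_rVS : set (borel_rV R n.+1) -> \bar R :=
  pushforward (@lebesgue_measure R \x mu)%E (@consrV n).

HB.instance Definition _ := Measure.copy lebesgue_rVS
  (measure_function_pushforward__canonical__measure_function_Measure
     (@lebesgue_measure R \x mu)%E (@measurable_consrV n)).

Let lebesgue_rVS_sigma_finite : sigma_finite setT lebesgue_rVS.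
Proof.
have [F FT mF] := sigma_finite_prod (@lebesgue_measure R) mu.
exists (fun k => @unconsrV n @^-1` F k).
  by rewrite -preimage_bigcup -FT preimage_setT.
move=> k; have [mFk Fk] := mF k; split.
  by rewrite -[X in measurable X]setTI; exact: measurable_unconsrV.
rewrite /lebesgue_rVS /pushforward -comp_preimage.
by rewrite (_ : _ \o _ = id)//; apply/funext => z; exact: consrVK.
Qed.

HB.instance Definition _ := Measure_isSigmaFinite.Build _ _ _ lebesgue_rVS
  lebesgue_rVS_sigma_finite.

End succ.

(* Up to the identification of R^n.+1 with R * R^n, the Lebesgue measure on    *)
(* R^n.+1 is the product of the Lebesgue measures on R and on R^n.             *)
Fixpoint lebesgue_rV n : {sigma_finite_measure set (borel_rV R n) -> \bar R} :=
  if n is n'.+1 then lebesgue_rVS (lebesgue_rV n') else \d_((0 : 'rV[R]_0) : borel_rV R 0).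

End lebesgue_rV.

(* LspaceType2 mu, the quotient of the square-integrable functions by equality *)
(* mu-almost everywhere, has no algebraic structure in the library; its        *)
(* vector space structure is the quotient of the pointwise one.                *)
Section Lspace2_lmodType.
Context d (T : measurableType d) (R : realType).
Variable mu : {measure set T -> \bar R}.
Local Notation fT := (LfunType mu (lee1n 2)).
Local Notation lT := (LspaceType2 mu).
Local Open Scope quotient_scope.

HB.instance Definition _ := gen_eqMixin lT.
HB.instance Definition _ := gen_choiceMixin lT.

Let repr_pi_ae (f : {mfun T >-> measurableTypeR R}) :
  (repr (\pi_(aeEqMfun (measurableTypeR R) mu) f) : T -> R) = f %[ae mu].
Proof.
have : ae_eq_op mu (repr (\pi_(aeEqMfun (measurableTypeR R) mu) f)) f.
  by apply/eqmodP; rewrite reprK.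
by move/asboolP.
Qed.

Lemma ae_eq_Lnorm2 (f g : {mfun T >-> measurableTypeR R}) :
  (f : T -> R) = g %[ae mu] ->
  ('N[mu]_2%:E[EFin \o f] = 'N[mu]_2%:E[EFin \o g])%E.
Proof.
move=> fg; rewrite unlock; congr poweR.
have m2 (h : {mfun T >-> measurableTypeR R}) :
    measurable_fun [set: T] (fun x => `|(EFin \o h) x| `^ 2)%E.
  apply: (measurableT_comp (measurable_poweR _)) => //.
  apply: measurableT_comp => //; apply/measurable_EFinP; exact: (measurable_funPT h).
apply: (ge0_ae_eq_integral measurableT (m2 f) (m2 g)).
- by move=> x _; exact: poweR_ge0.
- by move=> x _; exact: poweR_ge0.
- by move: fg; apply: filterS => x /= fgx _; rewrite fgx.
Qed.

Definition mfun_of (f : fT) : {mfun T >-> measurableTypeR R} :=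
  HB.pack (f : T -> measurableTypeR R)
    (@isMeasurableFun.Build _ _ T (measurableTypeR R) f (measurable_funPT f)).

Let pi_ae (f : {mfun T >-> measurableTypeR R}) : {mfun_ mu, T >-> measurableTypeR R} :=
  \pi f.

Let Lspace2_of_subproof (f : fT) : finite_norm mu 2%:E (pi_ae (mfun_of f)).
Proof.
rewrite /finite_norm (ae_eq_Lnorm2 (repr_pi_ae _)); exact: Lfunction_finite.
Qed.

Definition Lspace2_of (f : fT) : lT :=
  LebesgueSpace.Pack (LebesgueSpace.Class
    (isFinLebesgue.Axioms_ T R mu _ _ _ (Lspace2_of_subproof f))).

Lemma Lspace2_ofE f : (Lspace2_of f : T -> R) = f %[ae mu].
Proof. exact: (repr_pi_ae (mfun_of f)). Qed.

Lemma Lspace2_ae (f g : lT) : (f : T -> R) = g %[ae mu] -> f = g.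
Proof.
case: f => f [[f2]]; case: g => g [[g2]] /= fg.
have {}fg : f = g.
  rewrite -[f]reprK -[g]reprK; apply/eqmodP/asboolP; exact: fg.
by move: f2 g2; rewrite fg => f2 g2; rewrite (bool_irrelevance f2 g2).
Qed.

Let Lfun_of_subproof (f : lT) : (f : T -> R) \in Lfun mu 2%:E.
Proof.
case: f => f [[f2]] /=; rewrite !inE; apply/andP; split; last exact: mem_set.
by apply: mem_set; exact: (measurable_funPT (repr f)).
Qed.

Definition Lfun_of (f : lT) : fT := Lfun_Sub (lee1n 2) (Lfun_of_subproof f).

Lemma Lspace2_ofK : cancel Lfun_of Lspace2_of.
Proof. by move=> f; apply: Lspace2_ae; exact: Lspace2_ofE. Qed.

Let add (f g : lT) : lT := Lspace2_of (Lfun_of f + Lfun_of g).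
Let opp (f : lT) : lT := Lspace2_of (- Lfun_of f).
Let scale (a : R) (f : lT) : lT := Lspace2_of (a *: Lfun_of f).

Lemma eq_Lspace2_of (f g : fT) :
  (f : T -> R) = g %[ae mu] -> Lspace2_of f = Lspace2_of g.
Proof.
move=> fg; apply: Lspace2_ae; apply: ae_eq_trans (Lspace2_ofE f) _.
by apply: ae_eq_trans fg _; apply: ae_eq_sym; exact: Lspace2_ofE.
Qed.

Let addE f g : add (Lspace2_of f) (Lspace2_of g) = Lspace2_of (f + g).
Proof.
apply: eq_Lspace2_of; have := Lspace2_ofE f; have := Lspace2_ofE g.
by apply: filterS2 => x gx fx xT; rewrite -[RHS]/(f x + g x) -fx// -gx.
Qed.

Let oppE f : opp (Lspace2_of f) = Lspace2_of (- f).
Proof.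
apply: eq_Lspace2_of; have := Lspace2_ofE f.
by apply: filterS => x fx xT; rewrite -[RHS]/(- f x) -fx.
Qed.

Let scaleE a f : scale a (Lspace2_of f) = Lspace2_of (a *: f).
Proof.
apply: eq_Lspace2_of; have := Lspace2_ofE f.
by apply: filterS => x fx xT; rewrite -[RHS]/(a * f x) -fx.
Qed.

Let addA : associative add.
Proof.
by move=> f g h; rewrite -[f]Lspace2_ofK -[g]Lspace2_ofK -[h]Lspace2_ofK !addE addrA.
Qed.

Let addC : commutative add.
Proof. by move=> f g; rewrite /add addrC. Qed.

Let add0 : left_id (Lspace2_of 0) add.
Proof. by move=> f; rewrite -[f]Lspace2_ofK addE add0r. Qed.

Let addN : left_inverse (Lspace2_of 0) opp add.
Proof. by move=> f; rewrite -[f]Lspace2_ofK oppE addE addNr. Qed.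

HB.instance Definition _ := GRing.isZmodule.Build lT addA addC add0 addN.

Let scaleA a b f : scale a (scale b f) = scale (a * b) f.
Proof. by rewrite -[f]Lspace2_ofK !scaleE scalerA. Qed.

Let scale1 : left_id 1 scale.
Proof. by move=> f; rewrite -[f]Lspace2_ofK scaleE scale1r. Qed.

Let scaleDr : right_distributive scale +%R.
Proof.
move=> a f g; rewrite -[LHS]/(scale a (add f g)) -[RHS]/(add (scale a f) (scale a g)).
by rewrite -[f]Lspace2_ofK -[g]Lspace2_ofK addE !scaleE addE scalerDr.
Qed.

Let scaleDl f : {morph scale^~ f : a b / a + b}.
Proof.
move=> a b; rewrite -[RHS]/(add (scale a f) (scale b f)).
by rewrite -[f]Lspace2_ofK !scaleE addE scalerDl.
Qed.

HB.instance Definition _ := GRing.Zmodule_isLmodule.Build R lT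
  scaleA scale1 scaleDr scaleDl.

Lemma Lspace2_linearE a (f g : lT) :
  (a *: f + g : T -> R) = (fun x => a * f x + g x) %[ae mu].
Proof.
have -> : a *: f + g = Lspace2_of (a *: Lfun_of f + Lfun_of g).
  rewrite -[LHS]/(add (scale a f) g) -[in LHS](Lspace2_ofK f).
  by rewrite -[in LHS](Lspace2_ofK g) scaleE addE.
exact: Lspace2_ofE.
Qed.

End Lspace2_lmodType.

Section L2_quantities.
Context d (T : measurableType d) (R : realType).
Variable mu : {measure set T -> \bar R}.
Implicit Types f g : T -> R.

Definition L2norm f : R := fine 'N[mu]_2%:E[EFin \o f]%E.

Definition L2dot f g : R := (\int[mu]_x (f x * g x))%R.

(* The junk value 0 is returned by fine when mu setT = +oo. *)
Definition mean f : R := (fine (mu setT))^-1 * (\int[mu]_x f x)%R.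

End L2_quantities.

Section polyhedral.
Variables (R : realType) (d : nat).

(* A finite intersection of closed half-spaces, one for each column of A. *)
Definition convex_polyhedron (C : set 'rV[R]_d) :=
  exists (m : nat) (A : 'M[R]_(d, m)) (b : 'rV[R]_m),
    C = [set x | forall j, (x *m A) 0 j <= b 0 j].

(* The interior of a finite union of convex polyhedra, assumed to be nonempty, *)
(* bounded and connected; domain_regular excludes domains lying on both sides  *)
(* of a part of their boundary (slits).                                        *)
Record polyhedral_domain := PolyhedralDomain {
  domain :> set 'rV[R]_d ;
  domain_nonempty : domain !=set0 ;
  domain_open : open domain ;
  domain_connected : connected domain ;
  domain_bounded : bounded_set domain ;
  domain_regular : (closure domain)° = domain ;
  domain_polyhedral : exists (k : nat) (C : 'I_k -> set 'rV[R]_d),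
    (forall i, convex_polyhedron (C i)) /\ closure domain = \bigcup_i C i }.

Definition lebesgue_on (Om : polyhedral_domain) :
    {measure set (borel_rV R d) -> \bar R} :=
  mrestr (lebesgue_rV R d) (open_measurable_rV (@domain_open Om)).

(* L^2(Om) is realized on the whole space, with the Lebesgue measure restricted *)
(* to Om: the values outside Om are irrelevant.                                *)
Definition L2 (Om : polyhedral_domain) : Type := LspaceType2 (lebesgue_on Om).
HB.instance Definition _ Om := GRing.Lmodule.on (L2 Om).

End polyhedral.

Section linear_range.
Variables (R : realType) (V W : lmodType R) (r : {linear V -> W}).

(* The range of r as a vector space in its own right. *)
Definition in_range : {pred W} := fun w => `[< range r w >].

Lemma in_range_submod_closed : submod_closed in_range.
Proof.
split; first by apply/asboolP; exists 0; rewrite ?linear0.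
move=> a _ _ /asboolP[v _ <-] /asboolP[w _ <-].
by apply/asboolP; exists (a *: v + w); rewrite ?linearP.
Qed.

HB.instance Definition _ :=
  GRing.isSubmodClosed.Build R W in_range in_range_submod_closed.

Record linear_range := LinearRange {
  range_val :> W ; range_valP : range_val \in in_range }.

HB.instance Definition _ := [isSub for range_val].
HB.instance Definition _ := [Choice of linear_range by <:].
HB.instance Definition _ := [SubChoice_isSubLmodule of linear_range by <:].

Lemma mem_in_range (v : V) : r v \in in_range.
Proof. by apply/asboolP; exists v. Qed.

Definition to_range (v : V) : linear_range := LinearRange (mem_in_range v).

End linear_range.

Section norms.
Variables (R : realType) (V : lmodType R).
Implicit Types (N l : V -> R).

Definition is_seminorm N :=
  [/\ forall x, 0 <= N x, forall a x, N (a *: x) = `|a| * N x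
    & forall x y, N (x + y) <= N x + N y].

Definition is_norm N := is_seminorm N /\ (forall x, N x = 0 -> x = 0).

(* In the degenerate case V = {0} this is sup set0 = 0. *)
Definition dual_norm N l : R := sup [set l v / N v | v in [set v | v != 0]].

Definition bdiff (tau : R) (u : nat -> V) (n : nat) : V :=
  tau^-1 *: (u n - u n.-1).

End norms.

(* Main.v *)
(* Summing (D2) in time and adding (D3) gives, with s^n the n-th partial sum of
   tau * p_h^i,
     C_0 (r_h p^n, r_h q) - b_h(u^n, q) + c_h(s^n, q) = (G^n + phi^0, r_h q).
   Testing with q = p^n and (D1) with v = u^n cancels b_h.  Summation over n
   bounds tau c_h(s^n, p^n) = c_h(s^n, s^n - s^(n-1)) from below by half of
   c_h(s^N, s^N), and the inf-sup condition bounds the mean-free part of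
   r_h p^n by the norms of f^n and u^n.  Four times the energy identity plus
   twice the squared inf-sup bound gives the constants of the theorem.
   Two more facts are needed: Omega has finite measure, so constants are square
   integrable, and linear forms on U_h are bounded, so dual norms are genuine
   suprema; the latter follows from representing linear forms by a_h. *)

Require Import Defs.
From HB Require Import structures.
From mathcomp Require Import all_boot all_order all_algebra sesquilinear.
From mathcomp Require Import all_classical all_reals all_analysis.
From mathcomp Require Import ring lra.

Set Implicit Arguments.
Unset Strict Implicit.
Unset Printing Implicit Defensive.

Import Order.TTheory GRing.Theory Num.Theory.
Import numFieldNormedType.Exports.

Local Open Scope classical_set_scope.
Local Open Scope ring_scope.

(** * Finite Lebesgue measure of bounded domains *)

Lemma measurable_cube (R : realType) n (M : R) :
  measurable ([set x : 'rV[R]_n | forall i, `|x 0 i| <= M] : set (borel_rV R n)).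
Proof.
rewrite (_ : [set _ | _] = \bigcap_(i in [set: 'I_n])
    ([set: borel_rV R n] `&` (fun x : 'rV[R]_n => x 0 i) @^-1` `[- M, M])).
  apply: fin_bigcap_measurable => // i _.
  by apply: measurable_coord => //; exact: measurable_itv.
apply/seteqP; split=> x /=.
  by move=> h i _; split=> //=; rewrite in_itv/= -ler_norml.
by move=> h i; have [_ /=] := h i I; rewrite in_itv/= -ler_norml.
Qed.

(** Induction on [n]: through [consrV] the cube is an interval times a cube of one dimension less,
    and the product measure factors. For [M < 0] the interval is empty. *)
Lemma lebesgue_rV_cube_lty (R : realType) n (M : R) :
  (lebesgue_rV R n [set x : 'rV[R]_n | forall i, `|x 0 i| <= M]%R < +oo)%E.
Proof.
elim: n => [|n IHn].
  by rewrite /= diracE ltry.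
set C := [set x : 'rV[R]_n | forall i, `|x 0 i| <= M].
rewrite /= /lebesgue_rVS /pushforward.
rewrite (_ : _ @^-1` _ = [set` `[- M, M]] `*` (C : set (borel_rV R n))); last first.
  apply/seteqP; split=> -[a x] /=.
    move=> h; split=> [|i].
      by have := h ord0; rewrite mxE unlift_none/= in_itv/= ler_norml.
    by have := h (lift ord0 i); rewrite mxE liftK.
  rewrite in_itv/= -ler_norml => -[aM xM] i; rewrite mxE.
  by case: (unliftP ord0 i) => [j|] _ /=.
have mC := @measurable_cube R n M.
rewrite product_measure1E; [|exact: measurable_itv|exact: mC].
rewrite [X in (X * _)%E](lebesgue_measure_itv `[- M, M])/= lte_mul_pinfty//.
- by case: ifPn => //; rewrite lte_fin => h; rewrite lee_fin subr_ge0 ltW.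
- by case: ifPn.
Qed.

Lemma lebesgue_on_fin_num (R : realType) d (Om : polyhedral_domain R d) :
  lebesgue_on Om setT \is a fin_num.
Proof.
rewrite ge0_fin_numE//.
rewrite -[X in (X < _)%E]/(lebesgue_rV R d (setT `&` domain Om)) setTI.
have [M _ OmM] := ex_strict_bound_gt0 (domain_bounded Om).
apply: le_lt_trans (lebesgue_rV_cube_lty d M); apply: le_measure.
- by rewrite inE; apply: open_measurable_rV; exact: domain_open.
- rewrite inE; exact: measurable_cube.
- move=> x /OmM /= xM i; apply: le_trans (ltW xM).
  rewrite [leRHS]/Num.norm/= mx_normrE.
  exact: (@le_bigmax _ _ _ 0 (fun ij : 'I_1 * 'I_d => `|x ij.1 ij.2|) (0, i)).
Qed.

(** * Square-integrable functions, their means and Young inequalities *)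

Section L2.
Context d (T : measurableType d) (R : realType).
Variable mu : {measure set T -> \bar R}.
Implicit Types f g h : T -> R.

Lemma Lspace2_Lfun (f : LspaceType2 mu) : (f : T -> R) \in Lfun mu 2%:E.
Proof. exact: (LfunP (Lfun_of f)). Qed.

Lemma integrable_mul f g : f \in Lfun mu 2%:E -> g \in Lfun mu 2%:E ->
  mu.-integrable setT (EFin \o (fun x => f x * g x)).
Proof. by move=> fL gL; apply/Lfun1_integrable; exact: Lfun2_mul_Lfun1. Qed.

Lemma L2dotC f g : L2dot mu f g = L2dot mu g f.
Proof. by apply: eq_Rintegral => x _; rewrite mulrC. Qed.

Lemma L2dot_linear f g h a :
  f \in Lfun mu 2%:E -> g \in Lfun mu 2%:E -> h \in Lfun mu 2%:E ->
  L2dot mu (fun x => a * f x + g x) h = a * L2dot mu f h + L2dot mu g h.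
Proof.
move=> fL gL hL; have fh := integrable_mul fL hL; have gh := integrable_mul gL hL.
rewrite /L2dot -RintegralZl// -RintegralD//; last first.
  by have := integrableZl measurableT a fh.
by apply: eq_Rintegral => x _; rewrite mulrDl mulrA.
Qed.

Lemma L2norm_sqr f : f \in Lfun mu 2%:E -> L2norm mu f ^+ 2 = L2dot mu f f.
Proof.
move=> fL; have : ('N[mu]_2%:E[EFin \o f])%E \is a fin_num.
  rewrite ge0_fin_numE ?Lnorm_ge0//.
  by move: fL => /andP[_]; rewrite inE.
move=> Nf; have := @powR_Lnorm _ _ _ mu (EFin \o f) 2.
rewrite pnatr_eq0 -[X in (X `^ _)%E](fineK Nf) poweR_EFin.
rewrite powR_mulrn ?fine_ge0 ?Lnorm_ge0// => /(_ isT) N2.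
rewrite -[LHS]/(fine (_%:E)) N2; congr fine.
by apply: eq_integral => x _ /=; rewrite powR_mulrn// -normrX ger0_norm ?sqr_ge0.
Qed.

Lemma ae_eq_L2dot f g h : f = g %[ae mu] ->
  f \in Lfun mu 2%:E -> g \in Lfun mu 2%:E -> h \in Lfun mu 2%:E ->
  L2dot mu f h = L2dot mu g h.
Proof.
move=> fg fL gL hL; congr fine; apply: ae_eq_integral => //.
- by case/integrableP: (integrable_mul fL hL).
- by case/integrableP: (integrable_mul gL hL).
- by move: fg; apply: filterS => x /= fgx _; rewrite fgx.
Qed.

Lemma L2dot_ge0 f : 0 <= L2dot mu f f.
Proof. by apply: Rintegral_ge0 => x _; rewrite -expr2 sqr_ge0. Qed.

(** The operations of the quotient agree with the pointwise ones only almost everywhere, which the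
    integral does not see. *)
Lemma Lspace2_dot_linear (f g : LspaceType2 mu) h a : h \in Lfun mu 2%:E ->
  L2dot mu (a *: f + g) h = a * L2dot mu f h + L2dot mu g h.
Proof.
move=> hL; have [fL gL] := (Lspace2_Lfun f, Lspace2_Lfun g).
rewrite -L2dot_linear//; apply: ae_eq_L2dot => //.
- exact: Lspace2_linearE.
- exact: Lspace2_Lfun.
- exact: LfunP (a *: Lfun_of f + Lfun_of g).
Qed.

Section finite.
Hypothesis mu_fin : mu setT \is a fin_num.
Local Notation vol := (fine (mu setT)).

Lemma cst_Lfun2 c : (cst c : T -> R) \in Lfun mu 2%:E.
Proof.
apply/andP; split; rewrite inE//=.
rewrite /finite_norm unlock poweR_lty//=.
rewrite integral_cst// lte_mul_pinfty ?lee_fin ?powR_ge0//.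
by rewrite -ge0_fin_numE.
Qed.

(* Also true when [vol = 0]: the mean is then the junk value [0]. *)
Lemma mean_Rintegral f g : mean mu f * (\int[mu]_x g x) = mean mu f * mean mu g * vol.
Proof.
rewrite /mean; have [->|vol0] := eqVneq vol 0; first by rewrite invr0 !mul0r.
by field.
Qed.

Lemma Lfun2_integrable f : f \in Lfun mu 2%:E -> mu.-integrable setT (EFin \o f).
Proof.
move=> fL; have := integrable_mul fL (cst_Lfun2 1).
by under eq_fun do rewrite /= mulr1.
Qed.

Lemma subr_mean_Lfun2 f : f \in Lfun mu 2%:E ->
  (fun x => f x - mean mu f) \in Lfun mu 2%:E.
Proof.
move=> fL; have f2 := cst_Lfun2 (mean mu f).
by have := LfunP (Lfun_Sub (lee1n 2) fL - Lfun_Sub (lee1n 2) f2).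
Qed.

Lemma L2dot_subr_mean f h : f \in Lfun mu 2%:E -> h \in Lfun mu 2%:E ->
  L2dot mu h (fun x => f x - mean mu f) = L2dot mu h f - mean mu h * mean mu f * vol.
Proof.
move=> fL hL; have h1 := Lfun2_integrable hL.
rewrite [mean mu h * _]mulrC -mean_Rintegral /L2dot -RintegralZl// -RintegralB//.
- by apply: eq_Rintegral => x _; rewrite mulrBr [mean _ _ * _]mulrC.
- exact: integrable_mul.
- by have := integrableZl measurableT (mean mu f) h1.
Qed.

(** Pythagoras: [f - mean mu f] is orthogonal to constants. *)
Lemma L2norm_sqr_subr_mean f : f \in Lfun mu 2%:E ->
  L2norm mu (fun x => f x - mean mu f) ^+ 2
  = L2norm mu f ^+ 2 - mean mu f ^+ 2 * vol.
Proof.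
move=> fL; have fmL := subr_mean_Lfun2 fL.
rewrite !L2norm_sqr// L2dot_subr_mean// [L2dot mu _ f]L2dotC L2dot_subr_mean//.
(* The factor [mean mu f] makes [mean_Rintegral] applicable, so that [vol = 0] needs no separate
   case. *)
have : mean mu f * (\int[mu]_x (f x - mean mu f)) = 0.
  rewrite RintegralB//; last exact: Lfun2_integrable (cst_Lfun2 _).
    by rewrite mulrBr mean_Rintegral Rintegral_cst// -mulrA [_ * vol]mulrC mulrA subrr.
  exact: Lfun2_integrable.
by rewrite mean_Rintegral => m0; rewrite [X in _ - _ - X * _]mulrC m0 subr0 expr2.
Qed.

Lemma L2norm_sqr_cst c : L2norm mu (cst c) ^+ 2 = c ^+ 2 * vol.
Proof.
rewrite L2norm_sqr; last exact: cst_Lfun2.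
by rewrite /L2dot /= Rintegral_cst.
Qed.

Lemma L2dot_young f h e : f \in Lfun mu 2%:E -> h \in Lfun mu 2%:E -> 0 < e ->
  2 * L2dot mu h f <= e * L2norm mu f ^+ 2 + e^-1 * L2norm mu h ^+ 2.
Proof.
move=> fL hL e0; have fhL : (fun x => (- e) * f x + h x) \in Lfun mu 2%:E.
  by have := LfunP ((- e) *: Lfun_Sub (lee1n 2) fL + Lfun_Sub (lee1n 2) hL).
have := L2dot_ge0 (fun x => (- e) * f x + h x).
rewrite L2dot_linear// (L2dotC f) (L2dotC h) !L2dot_linear//.
rewrite !L2norm_sqr// [L2dot mu f h]L2dotC => sq.
rewrite -(ler_pM2l e0) mulrDr [e * (e^-1 * _)]mulrA divff ?gt_eqF// mul1r.
by nra.
Qed.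

(** The product splits into a mean-free part, estimated by Young, and a product of means, absorbed
    by [c * L2norm mu f ^+ 2] after completing a square. Two uses, for [G n] and [phi0], cost one
    full [k] in the mean-free part. *)
Lemma L2dot_le f h k c : f \in Lfun mu 2%:E -> h \in Lfun mu 2%:E ->
  0 < k -> 0 <= c -> (c = 0 -> \int[mu]_x f x = 0) ->
  4 * L2dot mu h f <=
    k / 2 * L2norm mu (fun x => f x - mean mu f) ^+ 2 + 8 / k * L2norm mu h ^+ 2
    + (c * L2norm mu f ^+ 2
       + if c == 0 then 0 else 4 / c * L2norm mu (cst (mean mu h)) ^+ 2).
Proof.
move=> fL hL k0 c0 f0; have fmL := subr_mean_Lfun2 fL.
have -> : L2dot mu h f = L2dot mu h (fun x => f x - mean mu f)
    + mean mu h * mean mu f * vol by rewrite L2dot_subr_mean// subrK.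
rewrite mulrDr lerD//.
  (* Twice Young's inequality with weight [k / 4] gives the factors [k / 2] and [8 / k]. *)
  have k4 : 0 < k / 4 by rewrite divr_gt0.
  have := L2dot_young fmL hL k4; rewrite invf_div => y.
  rewrite (_ : 8 / k = 2 * (4 / k)); last by rewrite mulrA -natrM.
  by lra.
case: eqVneq => [c00|c_neq0].
  by rewrite {2}/mean f0// c00 !(mulr0,mul0r,addr0).
have cp : 0 < c by rewrite lt_def c_neq0.
have vol0 : 0 <= vol by rewrite fine_ge0.
rewrite L2norm_sqr_cst.
have : c * (mean mu f ^+ 2 * vol) <= c * L2norm mu f ^+ 2.
  by rewrite ler_pM2l// -subr_ge0 -L2norm_sqr_subr_mean// sqr_ge0.
move=> fc; apply: (@le_trans _ _ (c * (mean mu f ^+ 2 * vol)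
    + 4 / c * (mean mu h ^+ 2 * vol))); last by rewrite lerD2r.
rewrite -subr_ge0.
rewrite (_ : _ - _ = c^-1 * (c * mean mu f - 2 * mean mu h) ^+ 2 * vol);
  last by field.
by apply: mulr_ge0 => //; apply: mulr_ge0; rewrite ?invr_ge0 ?sqr_ge0.
Qed.

End finite.
End L2.

(** * Linear forms and dual norms in finite dimension *)

Section dual_norm.
Variables (R : realType) (V : vectType R) (N : V -> R).
Hypothesis N_norm : is_norm N.
Implicit Type l : {scalar V}.

Let N_gt0 v : v != 0 -> 0 < N v.
Proof.
case: N_norm => -[N_ge0 _ _] N0 /eqP v0; rewrite lt_def N_ge0 andbT.
by apply/eqP => /N0.
Qed.

(** Finite-dimensional Lax-Milgram: [f w] has coordinates [a w e_i] in a basis; coercivity makes [f]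
    injective, hence invertible. *)
Lemma coercive_representation (a : {bilinear V -> V -> R | *%R & *%R}) c l :
  0 < c -> (forall v, c * N v ^+ 2 <= a v v) -> exists w, forall v, a w v = l v.
Proof.
move=> c0 ac; pose e := vbasis {:V}.
pose f w := \sum_(i < \dim {:V}) a w e`_i *: e`_i.
have f_lin : linear f.
  move=> k v w; rewrite /f scaler_sumr -big_split/=; apply: eq_bigr => i _.
  by rewrite linearPl scalerDl scalerA.
pose fL : {linear V -> V} := HB.pack f (GRing.isLinear.Build _ _ _ _ f f_lin).
have coordE (g : 'I_(\dim {:V}) -> R) i : coord e i (\sum_i g i *: e`_i) = g i.
  by rewrite coord_sum_free// (basis_free (vbasisP _)).
have ker0 : lker (linfun fL) == 0%VS.
  apply/eqP/vspaceP => w; rewrite memv0 memv_ker lfunE/=.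
  apply/eqP/eqP => [fw0|->]; last first.
    by rewrite /f big1// => i _; rewrite linear0l scale0r.
  have aw v : a w v = 0.
    rewrite (coord_vbasis (memvf v)) linear_sumr big1// => i _.
    rewrite linearZr_LR/= -(coordE (fun i : 'I_(\dim {:V}) => a w e`_i)) -/(f w).
    by rewrite fw0 linear0 mulr0.
  apply/eqP; rewrite -[_ == _]negbK; apply/negP => /N_gt0 Nw.
  by have := ac w; rewrite aw leNgt mulr_gt0// exprn_gt0.
pose y := \sum_(i < \dim {:V}) l e`_i *: e`_i.
exists ((linfun fL)^-1%VF y) => v.
rewrite [in RHS](coord_vbasis (memvf v)) [v in LHS](coord_vbasis (memvf v)).
rewrite linear_sumr (linear_sum l); apply: eq_bigr => i _.
rewrite linearZr_LR (linearZ_LR l)/=; congr (_ * _).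
rewrite -(coordE (fun i : 'I_(\dim {:V}) => l e`_i)) -/y.
by rewrite -{2}(lker0_lfunVK ker0 y) lfunE/= /f coordE.
Qed.

(** It makes [dual_norm] a genuine supremum: [sup] of an unbounded set is the default 0. *)
Definition bounded_form l := exists M, forall v, l v <= M * N v.

Lemma dual_normP l v : bounded_form l -> l v <= dual_norm N l * N v.
Proof.
case=> M lM; have [->|v0] := eqVneq v 0.
  rewrite linear0; case: N_norm => -[_ NZ _] _.
  by have := NZ 0 0; rewrite scale0r normr0 mul0r => ->; rewrite mulr0.
rewrite -ler_pdivrMr ?N_gt0//; apply: ub_le_sup; last by exists v.
exists M => _ [w /= w0 <-]; rewrite ler_pdivrMr ?N_gt0//.
Qed.

(** Since [sup set0] is 0, a negative value would require some [v != 0]; the bounds at [v] and [- v]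
    then add up to a contradiction. *)
Lemma dual_norm_ge0 l : bounded_form l -> 0 <= dual_norm N l.
Proof.
move=> lM; rewrite leNgt; apply/negP => D0.
have /set0P[_ [v v0 _]] : [set l v / N v | v in [set v | v != 0]] != set0.
  by apply/eqP => A0; move: D0; rewrite /dual_norm A0 sup0 ltxx.
have := dual_normP v lM; have := dual_normP (- v) lM.
have [[_ NZ _] _] := N_norm.
rewrite -scaleN1r NZ normrN1 mul1r linearZ/= mulN1r => lv1 lv2.
have := lerD lv1 lv2; rewrite addNr -mulrDl leNgt => /negP; apply.
by rewrite pmulr_llt0 ?N_gt0// -mulr2n pmulrn_llt0.
Qed.

Lemma dual_norm_le (l : V -> R) M : 0 <= M -> (forall v, l v <= M * N v) ->
  dual_norm N l <= M.
Proof.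
move=> M0 lM; rewrite /dual_norm; set A := [set _ | _ in _].
have [->|/set0P[x Ax]] := eqVneq A set0; first by rewrite sup0.
apply: ge_sup; first by exists x.
by move=> _ [w /= w0 <-]; rewrite ler_pdivrMr ?N_gt0//.
Qed.

End dual_norm.

(** * Summation in time and the energy estimate at one step *)

(** Telescoping of [2 c(S_n, d_n) = c(S_n, S_n) - c(S_(n-1), S_(n-1)) + c(d_n, d_n)] with
    [d_n = S_n - S_(n-1) = tau p_n]. *)
Lemma bilinear_partial_sums (R : realType) (V : lmodType R)
    (c : {bilinear V -> V -> R | *%R & *%R}) (tau : R) (p : nat -> V) m :
  (forall v w, c v w = c w v) -> (forall v, 0 <= c v v) ->
  c (\sum_(1 <= i < m.+1) tau *: p i) (\sum_(1 <= i < m.+1) tau *: p i)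
  <= 2 * \sum_(1 <= n < m.+1) tau * c (\sum_(1 <= i < n.+1) tau *: p i) (p n).
Proof.
move=> csym c0; elim: m => [|m IHm].
  by rewrite !big_geq// linear0l mulr0.
rewrite [in leRHS]big_nat_recr//= mulrDr.
rewrite ![\sum_(1 <= i < m.+2) _]big_nat_recr//=.
rewrite !(linearDl c)/= !(linearDr c)/= !(linearZl_LR c)/= !(linearZr_LR c)/=.
set S := \sum_(1 <= i < m.+1) tau *: p i in IHm *.
set E := \sum_(1 <= n < m.+1) _ in IHm *.
rewrite (csym (p m.+1) S).
by have := mulr_ge0 (sqr_ge0 tau) (c0 (p m.+1)); nra.
Qed.

(* [U], [F], [X] are the norms of u^n, f^n and of the mean-free part of r_h p^n,
   [P] is the squared norm of r_h p^n, and [dg], [dp] are the products of G^n and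
   phi^0 with r_h p^n, with mean-value contributions [eg], [ep]. *)
Lemma energy_step (R : realFieldType) (al au be C0 : R)
    (a c fu dg dp F U X P g2 p2 eg ep : R) :
  0 < al -> 0 < au -> 0 < be -> 0 <= X -> 0 <= C0 * P ->
  let K := be ^+ 2 * al / (2 * au ^+ 2) in
  al * U ^+ 2 <= a -> fu <= F * U -> be * X <= F + au * U ->
  a + C0 * P + c = fu + dg + dp ->
  4 * dg <= K / 2 * X ^+ 2 + 8 / K * g2 + (C0 * P + eg) ->
  4 * dp <= K / 2 * X ^+ 2 + 8 / K * p2 + (C0 * P + ep) ->
  al * U ^+ 2 + (C0 * P + K * X ^+ 2) + 4 * c
  <= (4 * au ^+ 2 + 2 * al ^+ 2) / (al * au ^+ 2) * F ^+ 2
     + 16 * au ^+ 2 / (al * be ^+ 2) * (g2 + p2) + (eg + ep).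
Proof.
move=> al0 au0 be0 X0 CP0 K ha hf hX hE hg hp.
have nz : (al != 0) * (au != 0) * (be != 0) by rewrite !gt_eqF.
have h1 : 4 * (F * U) <= al * U ^+ 2 + 4 / al * F ^+ 2.
  rewrite -subr_ge0 (_ : _ - _ = (al * U - 2 * F) ^+ 2 / al); last by field; rewrite nz.
  by rewrite divr_ge0 ?sqr_ge0// ltW.
(* The squared inf-sup bound, scaled by [al / (2 * au ^+ 2)]; this scaling is the origin of [K]. *)
have h2 : K * X ^+ 2 <= al / au ^+ 2 * F ^+ 2 + al * U ^+ 2.
  have bX : (be * X) ^+ 2 <= 2 * F ^+ 2 + 2 * (au * U) ^+ 2.
    have : (be * X) ^+ 2 <= (F + au * U) ^+ 2.
      rewrite ler_sqr ?nnegrE// ?mulr_ge0 ?(ltW be0)// (le_trans _ hX)//.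
      by rewrite mulr_ge0// ltW.
    by have := sqr_ge0 (F - au * U); nra.
  have k0 : 0 < al / (2 * au ^+ 2) by rewrite divr_gt0// mulr_gt0// exprn_gt0.
  have := ler_wpM2l (ltW k0) bX.
  rewrite (_ : _ * (be * X) ^+ 2 = K * X ^+ 2); last by rewrite /K; field; rewrite nz.
  by rewrite (_ : _ * (_ + _) = al / au ^+ 2 * F ^+ 2 + al * U ^+ 2)//; field; rewrite nz.
have -> : 16 * au ^+ 2 / (al * be ^+ 2) = 8 / K by rewrite /K; field; rewrite !nz.
have -> : (4 * au ^+ 2 + 2 * al ^+ 2) / (al * au ^+ 2) * F ^+ 2
    = 4 / al * F ^+ 2 + 2 * (al / au ^+ 2 * F ^+ 2) by field; rewrite !nz.
rewrite mulrDr.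
(* Four times [hE] with [h1], [hg], [hp] leaves [3 * al * U ^+ 2] on the left and [K * X ^+ 2] on
   the right. Adding [h2] twice keeps one copy of each on the left; a spare [C0 * P] is dropped. *)
by lra.
Qed.

(** * Time-integrated balance and the stability estimate *)

Theorem lemma8
  (R : realType) (d : nat) (hd : d = 2%N \/ d = 3%N)
  (Om : polyhedral_domain R d)
  (tF C0 : R) (htF : 0 < tF) (hC0 : 0 <= C0)
  (N : nat) (hN : (1 <= N)%N)
  (* discrete spaces and forms *)
  (Uh Ph : vectType R) (rh : {linear Ph -> L2 Om})
  (ah : {bilinear Uh -> Uh -> R | *%R & *%R})
  (bh : {bilinear Uh -> Ph -> R | *%R & *%R})
  (ch : {bilinear Ph -> Ph -> R | *%R & *%R})
  (bt : {bilinear Uh -> linear_range rh -> R | *%R & *%R})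
  (ch_sym : forall p q, ch p q = ch q p)
  (bhE : forall v q, bh v q = bt v (to_range rh q))
  (* data *)
  (fh : nat -> {scalar Uh}) (g : nat -> L2 Om) (phi0 : L2 Om)
  (phi0_mean : C0 = 0 -> \int[lebesgue_on Om]_x phi0 x = 0)
  (g_mean : C0 = 0 -> forall n, (1 <= n <= N)%N ->
     \int[lebesgue_on Om]_x g n x = 0)
  (* stability *)
  (normU : Uh -> R) (normU_norm : is_norm normU)
  (normP : Ph -> R) (normP_seminorm : is_seminorm normP)
  (normP_definite : forall q, \int[lebesgue_on Om]_x rh q x = 0 ->
     normP q = 0 -> q = 0)
  (alpha_lo alpha_up gamma beta : R)
  (alpha_lo_gt0 : 0 < alpha_lo) (alpha_le : alpha_lo <= alpha_up)
  (gamma_gt0 : 0 < gamma) (beta_gt0 : 0 < beta)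
  (ah_coercive : forall v, alpha_lo * normU v ^+ 2 <= ah v v)
  (ah_bounded : forall w v, ah w v <= alpha_up * normU w * normU v)
  (ch_coercive : forall q, gamma * normP q ^+ 2 <= ch q q)
  (inf_sup : forall q,
     beta * L2norm (lebesgue_on Om)
       (fun x => rh q x - mean (lebesgue_on Om) (rh q))
     <= dual_norm normU (fun v => bh v q))
  (* solution of the abstract discrete problem, with time step tF / N *)
  (u : nat -> Uh) (p : nat -> Ph)
  (D1 : forall n, (1 <= n <= N)%N -> forall v,
     ah (u n) v + bh v (p n) = fh n v)
  (D2 : forall n, (1 <= n <= N)%N -> forall q,
     C0 * L2dot (lebesgue_on Om) (rh (bdiff (tF / N%:R) p n)) (rh q)
       - bh (bdiff (tF / N%:R) u n) q + ch (p n) q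
     = L2dot (lebesgue_on Om) (g n) (rh q))
  (D3 : forall q,
     C0 * L2dot (lebesgue_on Om) (rh (p 0%N)) (rh q) - bh (u 0%N) q
     = L2dot (lebesgue_on Om) phi0 (rh q))
  (D4 : C0 = 0 -> forall n, (1 <= n <= N)%N ->
     \int[lebesgue_on Om]_x rh (p n) x = 0) :
  let mu := lebesgue_on Om in
  let tau := tF / N%:R in
  let sN : Ph := \sum_(1 <= i < N.+1) tau *: p i in
  let G n : L2 Om := \sum_(1 <= i < n.+1) tau *: g i in
  let C1 := (4 * alpha_up ^+ 2 + 2 * alpha_lo ^+ 2) / (alpha_lo * alpha_up ^+ 2) in
  let C2 := 16 * alpha_up ^+ 2 / (alpha_lo * beta ^+ 2) in
  let C3 := 4 / C0 in
  alpha_lo * (\sum_(1 <= n < N.+1) tau * normU (u n) ^+ 2)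
  + \sum_(1 <= n < N.+1) tau *
      (C0 * L2norm mu (rh (p n)) ^+ 2
       + beta ^+ 2 * alpha_lo / (2 * alpha_up ^+ 2)
         * L2norm mu (fun x => rh (p n) x - mean mu (rh (p n))) ^+ 2)
  + gamma * normP sN ^+ 2
  <= C1 * (\sum_(1 <= n < N.+1) tau * dual_norm normU (fh n) ^+ 2)
     + C2 * (\sum_(1 <= n < N.+1) tau * L2norm mu (G n) ^+ 2
             + tF * L2norm mu phi0 ^+ 2)
     + (if C0 == 0 then 0 else
        C3 * (\sum_(1 <= n < N.+1) tau * L2norm mu (cst (mean mu (G n))) ^+ 2
              + tF * L2norm mu (cst (mean mu phi0)) ^+ 2)).
Proof.
pose mu := lebesgue_on Om; pose tau := tF / N%:R.
pose sN : Ph := \sum_(1 <= i < N.+1) tau *: p i.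
pose G n : L2 Om := \sum_(1 <= i < n.+1) tau *: g i.
pose C1 := (4 * alpha_up ^+ 2 + 2 * alpha_lo ^+ 2) / (alpha_lo * alpha_up ^+ 2).
pose C2 := 16 * alpha_up ^+ 2 / (alpha_lo * beta ^+ 2).
pose C3 := 4 / C0.
cbv zeta; rewrite -/mu -/tau -/sN -/G -/C1 -/C2 -/C3.
have mu_fin : mu setT \is a fin_num by exact: lebesgue_on_fin_num.
have L2f (f : L2 Om) : (f : _ -> R) \in Lfun mu 2%:E by exact: Lspace2_Lfun.
have tau0 : 0 < tau by rewrite divr_gt0// ltr0n.
have alpha_up_gt0 : 0 < alpha_up by exact: lt_le_trans alpha_le.
have [[U_ge0 _ _] _] := normU_norm.
have bounded l : bounded_form normU l.
  have [w aw] := coercive_representation normU_norm l alpha_lo_gt0 ah_coercive.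
  by exists (alpha_up * normU w) => v; rewrite -aw ah_bounded.
pose s n : Ph := \sum_(1 <= i < n.+1) tau *: p i.
have dotPl (f h k : L2 Om) a : L2dot mu (a *: f + h : L2 Om) k
    = a * L2dot mu f k + L2dot mu h k by exact: Lspace2_dot_linear.
have balance n q : (n <= N)%N ->
    C0 * L2dot mu (rh (p n)) (rh q) - bh (u n) q + ch (s n) q
    = L2dot mu (G n) (rh q) + L2dot mu phi0 (rh q).
  elim: n => [_|n IHn nN].
    rewrite /s /G !big_geq// linear0l addr0 D3.
    (* The class [0] is the zero function only almost everywhere, so its pairing is computed by
       linearity from [0 = -1 *: 0 + 0]. *)
    have := dotPl 0 0 (rh q) (-1); rewrite scaler0 addr0 mulN1r addNr => ->.
    by rewrite add0r.
  have sE : s n.+1 = tau *: p n.+1 + s n by rewrite /s big_nat_recr//= addrC.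
  have GE : G n.+1 = tau *: g n.+1 + G n by rewrite /G big_nat_recr//= addrC.
  have pE : rh (p n.+1) = tau *: rh (bdiff tau p n.+1) + rh (p n).
    by rewrite -linearZ -linearD /bdiff scalerA divff ?gt_eqF// scale1r subrK.
  have uE : u n.+1 = tau *: bdiff tau u n.+1 + u n.
    by rewrite /bdiff scalerA divff ?gt_eqF// scale1r subrK.
  rewrite sE GE pE [in bh _ _]uE !dotPl (linearPl bh) (linearPl ch)/=.
  have := IHn (ltnW nN); have := D2 n.+1 nN q; rewrite -/tau -/mu => <-.
  by lra.
pose K := beta ^+ 2 * alpha_lo / (2 * alpha_up ^+ 2).
have K0 : 0 < K by rewrite divr_gt0 ?mulr_gt0 ?exprn_gt0.
pose E (f : L2 Om) :=
  if C0 == 0 then 0 else C3 * L2norm mu (cst (mean mu f)) ^+ 2.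
have step n : (1 <= n < N.+1)%N ->
    alpha_lo * normU (u n) ^+ 2
    + (C0 * L2norm mu (rh (p n)) ^+ 2
       + K * L2norm mu (fun x => rh (p n) x - mean mu (rh (p n))) ^+ 2)
    + 4 * ch (s n) (p n)
    <= C1 * dual_norm normU (fh n) ^+ 2
       + C2 * (L2norm mu (G n) ^+ 2 + L2norm mu phi0 ^+ 2) + (E (G n) + E phi0).
  rewrite ltnS => nN; have /andP[_ n_le] := nN.
  have mean0 : C0 = 0 -> \int[mu]_x rh (p n) x = 0 by move=> C00; exact: D4.
  have dot_le (f : L2 Om) := L2dot_le mu_fin (L2f (rh (p n))) (L2f f) K0 hC0 mean0.
  apply: (energy_step (a := ah (u n) (u n)) (fu := fh n (u n)))
    (dot_le (G n)) (dot_le phi0) => //.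
  - by rewrite fine_ge0 ?Lnorm_ge0.
  - by rewrite mulr_ge0 ?sqr_ge0.
  - exact: dual_normP.
  - apply: le_trans (inf_sup (p n)) _; apply: dual_norm_le => //.
      by rewrite addr_ge0 ?dual_norm_ge0// mulr_ge0// ltW.
    (* The sign moves into the argument because [ah_bounded] is one-sided. *)
    move=> v; have -> : bh v (p n) = fh n v + ah (u n) (- v).
      by rewrite -D1// linearNr addrAC subrr add0r.
    rewrite mulrDl lerD ?dual_normP//; apply: le_trans (ah_bounded _ _) _.
    by have [[_ NZ _] _] := normU_norm; rewrite -scaleN1r NZ normrN1 mul1r.
  - rewrite -D1// L2norm_sqr// -[RHS]addrA -balance//; lra.
(* The right-hand side is at least [2 * ch sN sN]; one copy suffices and the other is
   nonnegative. *)
have csum : gamma * normP sN ^+ 2 <= 4 * \sum_(1 <= n < N.+1) tau * ch (s n) (p n).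
  have ch0 v : 0 <= ch v v.
    by apply: le_trans (ch_coercive v); rewrite mulr_ge0 ?sqr_ge0// ltW.
  have := bilinear_partial_sums tau p N ch_sym ch0.
  have := ch_coercive sN; have := ch0 sN; lra.
(* This spreads the [phi0] terms evenly over the time steps, to match [step]. *)
have tFE (x : R) : tF * x = \sum_(1 <= n < N.+1) tau * x.
  rewrite sumr_const_nat subSS subn0 -mulrnAl -[tau *+ N]mulr_natr /tau.
  by rewrite divfK// pnatr_eq0 -lt0n.
have sumE : \sum_(1 <= n < N.+1) tau * (E (G n) + E phi0)
    = if C0 == 0 then 0 else
      C3 * (\sum_(1 <= n < N.+1) tau * L2norm mu (cst (mean mu (G n))) ^+ 2
            + tF * L2norm mu (cst (mean mu phi0)) ^+ 2).
  rewrite /E; case: ifP => _.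
    by rewrite big1// => n _; rewrite addr0 mulr0.
  rewrite tFE -big_split/= mulr_sumr; apply: eq_bigr => n _; ring.
rewrite -sumE tFE !mulr_sumr -!big_split/= mulr_sumr -!big_split/=.
apply: (@le_trans _ _ (\sum_(1 <= n < N.+1) tau * (alpha_lo * normU (u n) ^+ 2
    + (C0 * L2norm mu (rh (p n)) ^+ 2
       + K * L2norm mu (fun x => rh (p n) x - mean mu (rh (p n))) ^+ 2)
    + 4 * ch (s n) (p n)))).
  apply: le_trans (lerD (lexx _) csum) _.
  rewrite mulr_sumr -!big_split/= le_eqVlt; apply/orP; left; apply/eqP.
  by apply: eq_bigr => n _; rewrite /K; ring.
apply: le_trans (ler_sum_nat (fun n nN => ler_wpM2l (ltW tau0) (step n nN))) _.
rewrite le_eqVlt; apply/orP; left; apply/eqP.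
by apply: eq_bigr => n _; ring.
Qed.
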